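(* Let $\beta>0$ and let $V:\mathbb{R}^d\to\mathbb{R}$ be smooth such that $\pi\propto\exp(-V)$ is a probability measure on $\mathbb{R}^d$. Suppose that $$\frac{\|\mathbb{E}_\pi\nabla f\|^2}{\mathbb{E}_\pi f}\le2\beta\,\mathrm{ent}_\pi(f)\qquad\text{for all smooth }f:\mathbb{R}^d\to\mathbb{R}_{>0}.$$ Then, under $\pi$, the score $\nabla V$ is $\sqrt\beta$-sub-Gaussian; that is, for every unit vector $e\in\mathbb{R}^d$ and every $\lambda\in\mathbb{R}$, $$\mathbb{E}_\pi\exp\bigl(\lambda\,\langle e,\nabla V\rangle\bigr)\le\exp\Bigl(\frac{\beta\lambda^2}{2}\Bigr).$$
   Context: $\mathrm{ent}_\pi(f)=\mathbb{E}_\pi[f\log f]-\mathbb{E}_\pi[f]\log\mathbb{E}_\pi[f]$. The assumed inequality is required for those smooth positive $f$ for which $\mathbb{E}_\pi\|\nabla f\|$, $\mathbb{E}_\pi f$ and $\mathbb{E}_\pi[f|\log f|]$ are finite. A random vector $X$ in $\mathbb{R}^d$ is called $\sigma$-sub-Gaussian if for every unit vector $e$ and every $\lambda\in\mathbb{R}$, $\mathbb{E}\exp(\lambda\langle e,X\rangle)\le\exp(\lambda^2\sigma^2/2)$. *)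

(* Defs.v *)
From HB Require Import structures.
From mathcomp Require Import all_boot all_order all_algebra.
From mathcomp Require Import all_classical all_reals all_analysis.
From mathcomp Require Import measurable_realfun.

Set Implicit Arguments.
Unset Strict Implicit.
Unset Printing Implicit Defensive.

Import Order.TTheory GRing.Theory Num.Theory.
Import numFieldNormedType.Exports.

Local Open Scope classical_set_scope.
Local Open Scope ring_scope.

Section rV_measurable.
Context {R : realType} {d : nat}.

Let rV_measurable : set (set 'rV[R]_d) := <<s [set A | open A] >>.

Let rV_measurable0 : rV_measurable set0.
Proof. exact: sigma_algebra0. Qed.

Let rV_measurableC A : rV_measurable A -> rV_measurable (~` A).
Proof. exact: sigma_algebraC. Qed.

Let rV_measurable_bigcup (F : (set 'rV[R]_d)^nat) :
  (forall i, rV_measurable (F i)) -> rV_measurable (\bigcup_i F i).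
Proof. exact: sigma_algebra_bigcup. Qed.

HB.instance Definition _ := @isMeasurable.Build default_measure_display
  'rV[R]_d rV_measurable rV_measurable0 rV_measurableC rV_measurable_bigcup.

Lemma open_measurable_rV (A : set 'rV[R]_d) : open A -> measurable A.
Proof. exact: sub_sigma_algebra. Qed.

Lemma continuous_measurable_rV (f : 'rV[R]_d -> R) :
  continuous f -> measurable_fun setT f.
Proof.
move=> cf; apply: (measurability _ (RGenOpens.measurableE R)).
move=> _ [_ [a [b ->] <-]]; rewrite setTI; apply: open_measurable_rV.
by apply: open_comp; [move=> + _; exact: cf|exact: interval_open].
Qed.

Lemma rV_nbhs_rat_ball (A : set 'rV[R]_d) (x : 'rV[R]_d) : open A -> A x ->
  exists (q : 'rV[rat]_d) (k : nat),
    ball (map_mx (@ratr R) q) k.+1%:R^-1 x /\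
    ball (map_mx (@ratr R) q) k.+1%:R^-1 `<=` A.
Proof.
move=> oA Ax; have /nbhs_ballP[e /= e0 eA] := open_nbhs_nbhs (conj oA Ax).
have e2 : 0 < e / 2 by rewrite divr_gt0.
near \oo => k.
have ke : k.+1%:R^-1 < e / 2 by near: k; exact: near_infty_natSinv_lt (PosNum e2).
have k0 : 0 < k.+1%:R^-1 :> R by rewrite invr_gt0.
have /choice[q Hq] (j : 'I_d) : exists r : rat, `|ratr r - x 0 j| < k.+1%:R^-1.
  have /rat_in_itvoo[r] : x 0 j - k.+1%:R^-1 < x 0 j + k.+1%:R^-1.
    by rewrite ltrD2l gt0_cp.
  by rewrite in_itv/= -ltr_distl => ?; exists r.
exists (\row_j q j), k; split.
  by split=> // i j; rewrite !mxE/= ord1; exact: Hq.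
move=> y [_ By]; apply: eA; split=> // i j.
rewrite (splitr e); apply: (@ball_triangle _ _ (ratr (q j) : R)).
  by apply: ball_sym; rewrite ord1; apply: lt_trans ke; exact: Hq.
have := By i j; rewrite !mxE; apply: le_ball; exact: ltW.
Unshelve. all: by end_near. Qed.

End rV_measurable.

Section lebesgue_rV.
Context {R : realType}.

Definition rV_cons d (p : measurableTypeR R * 'rV[R]_d) : 'rV[R]_d.+1 :=
  \row_i (if unlift ord0 i is Some j then p.2 0 j else p.1).

Definition rV_uncons d (v : 'rV[R]_d.+1) : measurableTypeR R * 'rV[R]_d :=
  (v 0 ord0, \row_j v 0 (lift ord0 j)).

Lemma rV_consK d : cancel (@rV_cons d) (@rV_uncons d).
Proof.
move=> [x v]; rewrite /rV_uncons /rV_cons mxE unlift_none; congr pair.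
by apply/rowP => j; rewrite !mxE liftK.
Qed.

Lemma rV_unconsK d : cancel (@rV_uncons d) (@rV_cons d).
Proof.
move=> v; apply/rowP => i; rewrite mxE.
by case: unliftP => [j ->|->]//=; rewrite mxE.
Qed.

Lemma measurable_rV_cons d : measurable_fun setT (@rV_cons d).
Proof.
apply: (measurability [set A : set 'rV[R]_d.+1 | open A]) => //.
move=> _ [A oA <-]; rewrite setTI.
pose c (z : 'rV[rat]_d.+1 * nat) := map_mx (@ratr R) z.1.
pose r (z : 'rV[rat]_d.+1 * nat) : R := z.2.+1%:R^-1.
pose B z : set (measurableTypeR R * 'rV[R]_d) :=
  if `[< ball (c z) (r z) `<=` A >]
  then ball (c z 0 ord0) (r z) `*` ball (\row_j c z 0 (lift ord0 j)) (r z)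
  else set0.
have -> : @rV_cons d @^-1` A = \bigcup_z B z.
  apply/seteqP; split=> [[x v] /= Axv|[x v] [z _]]; rewrite /B.
    have [q [k [[k0 Bq] sq]]] := rV_nbhs_rat_ball oA Axv.
    exists (q, k) => //; rewrite asboolT//; split.
      by have := Bq 0 ord0; rewrite !mxE unlift_none.
    split=> // i j; rewrite ord1.
    by have := Bq 0 (lift ord0 j); rewrite !mxE liftK.
  case: ifPn => // /asboolP sA [/= Bx [k0 Bv]]; apply: sA; split=> // i j.
  rewrite ord1 [rV_cons _ _ _]mxE; case: unliftP => [l ->|->]//=.
  by have := Bv 0 l; rewrite !mxE.
apply: countable_bigcupT_measurable => // z; rewrite /B.
case: ifPn => // _; apply: measurableX.
  by apply: open_measurable; exact: ball_open.
by apply: open_measurable_rV; exact: ball_open.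
Qed.

Lemma measurable_rV_uncons d : measurable_fun setT (@rV_uncons d).
Proof.
apply: measurable_fun_pair.
  exact: (continuous_measurable_rV (@coord_continuous _ _ _ _ _)).
apply: (measurability [set A : set 'rV[R]_d | open A]) => //.
move=> _ [A oA <-]; rewrite setTI; apply: open_measurable_rV.
apply: open_comp => // v _.
move=> B /nbhs_ballP[e e0 eB]; apply/nbhs_ballP; exists e => // w [_ vw].
by apply: eB; split=> // i j; rewrite !mxE; exact: vw.
Qed.

Section lebesgue_rVS.
Context {d : nat} (m : {sigma_finite_measure set 'rV[R]_d -> \bar R}).

Definition lebesgue_rVS : set 'rV[R]_d.+1 -> \bar R :=
  pushforward (@lebesgue_measure R \x m)%E (@rV_cons d).

Let lebesgue_rVS0 : lebesgue_rVS set0 = 0%E.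
Proof. by rewrite /lebesgue_rVS /pushforward preimage_set0 measure0. Qed.

Let lebesgue_rVS_ge0 A : (0 <= lebesgue_rVS A)%E.
Proof. by rewrite /lebesgue_rVS /pushforward. Qed.

Let lebesgue_rVS_sigma_additive : semi_sigma_additive lebesgue_rVS.
Proof.
have mcons B : measurable B -> measurable (@rV_cons d @^-1` B).
  by move=> mB; rewrite -[X in measurable X]setTI; exact: measurable_rV_cons.
move=> F mF tF mUF; rewrite /lebesgue_rVS /pushforward preimage_bigcup.
apply: measure_semi_sigma_additive.
- by move=> n; exact: mcons.
- apply/trivIsetP => i j _ _ ij; rewrite -preimage_setI.
  by move/trivIsetP : tF => /(_ _ _ Logic.I Logic.I ij) ->; rewrite preimage_set0.
- by rewrite -preimage_bigcup; exact: mcons.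
Qed.

HB.instance Definition _ := isMeasure.Build _ _ _ lebesgue_rVS
  lebesgue_rVS0 lebesgue_rVS_ge0 lebesgue_rVS_sigma_additive.

Let lebesgue_rVS_sigma_finite : sigma_finite setT lebesgue_rVS.
Proof.
have cons_pre (B : set (measurableTypeR R * 'rV[R]_d)) :
    @rV_cons d @^-1` (@rV_uncons d @^-1` B) = B.
  by apply/seteqP; split=> p /=; rewrite rV_consK.
have /sigma_finiteP[F [TF ndF Foo]] := sigma_finiteT (@lebesgue_measure R).
have /sigma_finiteP[G [TG ndG Goo]] := sigma_finiteT m.
exists (fun n => @rV_uncons d @^-1` (F n `*` G n)).
  rewrite -preimage_bigcup (_ : \bigcup_n _ = setT) ?preimage_setT//.
  rewrite -setXTT TF TG predeqE => -[x y]; split.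
    by move=> [n _ []/= ? ?]; split; exists n.
  move=> [/= [n _ Fnx] [k _ Gky]]; exists (maxn n k) => //; split.
  - by move: x Fnx; exact/subsetPset/ndF/leq_maxl.
  - by move: y Gky; exact/subsetPset/ndG/leq_maxr.
move=> k; have [? ?] := Foo k; have [? ?] := Goo k; split.
  rewrite -[X in measurable X]setTI; apply: measurable_rV_uncons => //.
  exact: measurableX.
rewrite /lebesgue_rVS /pushforward cons_pre.
by rewrite product_measure1E// lte_mul_pinfty// ge0_fin_numE.
Qed.

HB.instance Definition _ := Measure_isSigmaFinite.Build _ _ _ lebesgue_rVS
  lebesgue_rVS_sigma_finite.

End lebesgue_rVS.

(* The point mass in dimension 0 and, in dimension d.+1, the image of the product
   measure under R * R^d -> R^(d.+1); see lebesgue_rV_box. *)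
Fixpoint lebesgue_rV d : {sigma_finite_measure set 'rV[R]_d -> \bar R} :=
  if d is d'.+1 then lebesgue_rVS (lebesgue_rV d')
  else dirac (0 : 'rV[R]_0).

Lemma lebesgue_rV_box d (A : 'I_d -> set (measurableTypeR R)) :
  (forall i, measurable (A i)) ->
  lebesgue_rV d [set v : 'rV[R]_d | forall i, A i (v 0 i)] =
  (\prod_(i < d) lebesgue_measure (A i))%E.
Proof.
elim: d A => [|d IH] A mA /=.
  by rewrite big_ord0 diracE mem_set//= => -[].
rewrite big_ord_recl -IH// -product_measure1E//.
  rewrite /lebesgue_rVS /pushforward; congr product_measure1.
  apply/seteqP; split=> [[x v] /= Av|[x v] /= [Ax Av] i].
    split=> [|i]; first by have := Av ord0; rewrite mxE unlift_none.
    by have := Av (lift ord0 i); rewrite mxE liftK.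
  by rewrite mxE; case: unliftP => [j ->|->]/=.
suff -> : [set v : 'rV[R]_d | forall i, A (lift ord0 i) (v 0 i)] =
    \bigcap_i (fun v => v 0 i) @^-1` A (lift ord0 i).
  apply: fin_bigcap_measurable => // i _; rewrite -[X in measurable X]setTI.
  by apply: (continuous_measurable_rV (@coord_continuous _ _ _ 0 i)) => //; exact: mA.
by apply/seteqP; split=> v Av i; [move=> _|]; exact: Av.
Qed.

End lebesgue_rV.

Section euclidean_calculus.
Context {R : realType} {d : nat}.
Implicit Types (u v : 'rV[R]_d) (f : 'rV[R]_d -> R).

Definition dotv u v : R := \sum_i u 0 i * v 0 i.

(* The library norm `|u| on 'rV[R]_d is the sup norm. *)
Definition norm2 u : R := Num.sqrt (dotv u u).

Definition partial (i : 'I_d) f : 'rV[R]_d -> R := 'D_(delta_mx 0 i) f.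

Definition grad f (x : 'rV[R]_d) : 'rV[R]_d := \row_i partial i f x.

(* Ck k f: all partial derivatives of order <= k exist and are continuous; total
   differentiability is included at each step below the last. *)
Fixpoint Ck (k : nat) f : Prop :=
  if k is k'.+1 then
    (forall x, differentiable f x) /\ (forall i, Ck k' (partial i f))
  else continuous f.

Definition smooth f : Prop := forall k, Ck k f.

End euclidean_calculus.

Section probability_rV.
Context {R : realType} {d : nat}.
Variable P : probability 'rV[R]_d R.

Definition is_gibbs (V : 'rV[R]_d -> R) : Prop :=
  exists2 c : R, 0 < c & forall A, measurable A ->
    P A = (\int[lebesgue_rV d]_(x in A) (c * expR (- V x))%:E)%E.

(* fine sends +oo and -oo to 0; only meaningful for integrable f. *)
Definition esp (f : 'rV[R]_d -> R) : R := fine 'E_P[f].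

Definition espv (X : 'rV[R]_d -> 'rV[R]_d) : 'rV[R]_d :=
  \row_i esp (fun x => X x 0 i).

Definition ent (f : 'rV[R]_d -> R) : R :=
  esp (fun x => f x * ln (f x)) - esp f * ln (esp f).

Definition sub_gaussian (sigma : R) (X : 'rV[R]_d -> 'rV[R]_d) : Prop :=
  forall (e : 'rV[R]_d) (lambda : R), norm2 e = 1 ->
    ('E_P[fun x => expR (lambda * dotv e (X x))] <=
     (expR (lambda ^+ 2 * sigma ^+ 2 / 2))%:E)%E.

End probability_rV.

(* Main.v *)
Require Import Defs.
From HB Require Import structures.
From mathcomp Require Import all_boot all_order all_algebra.
From mathcomp Require Import all_classical all_reals all_analysis.
From mathcomp Require Import measurable_realfun ring lra.
Import Order.TTheory GRing.Theory Num.Theory.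
Import numFieldNormedType.Exports.
Local Open Scope classical_set_scope.
Local Open Scope ring_scope.

(** Write s for the score component <e, grad V>.  For a smooth compactly
    supported psi, integration by parts against the density c exp(-V) gives
    E[grad psi] = E[psi grad V], so applying the assumed inequality to a
    positive f close to psi bounds (E[psi s])^2 / E[psi] by 2 beta ent(psi).

    Take psi = chi exp(lambda s), with 0 <= chi <= 1 a smooth cutoff.  Then
    psi ln psi <= lambda s psi pointwise, hence, with Z = E[psi] and
    q = E[psi s], ent(psi) <= lambda q - Z ln Z.  The inequality becomes
    (q / Z)^2 <= 2 beta (lambda q / Z - ln Z), that is
      ln Z <= lambda p - p^2 / (2 beta)   with p = q / Z,
    and the right-hand side is at most beta lambda^2 / 2 for every p.  Letting
    chi tend to 1 and using Fatou's lemma bounds E[exp(lambda s)].  No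
    integrability of the score is needed, because of the cutoff.

    As f has to be positive everywhere, the inequality is applied to a + psi
    with a > 0 constant.  The cost is an error of order a in the entropy
    ([perturbed_xlnx_le]), which disappears in the limit a -> 0
    ([legendre_bound]).  The remaining ingredients are the smooth cutoff
    ([is_derive_flat], [smooth_cutoff]), the vanishing of the Lebesgue integral
    of a partial derivative of a compactly supported function
    ([integral_partial_supported]) and its consequence [esp_partial]. *)

(** * Flat functions on the real line *)

Section flat.
Set Implicit Arguments.
Context {R : realType}.

Lemma exprM_expRN_le (k : nat) (y : R) : 0 <= y ->
  y ^+ k * expR (- y) <= k`!%:R.
Proof.
move=> y0; case: k => [|k]; first by rewrite expr0 mul1r -expR0 ler_expR oppr_le0.
rewrite expRN ler_pdivrMr ?expR_gt0// mulrC -ler_pdivrMr ?ltr0n ?fact_gt0//.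
by apply: le_trans (expR_ge1Dxn k y0); rewrite lerDr.
Qed.

Lemma horner_expRN_bounded (p : {poly R}) :
  exists2 C, 0 <= C & forall y, 0 <= y -> `|p.[y] * expR (- y)| <= C.
Proof.
exists (\sum_(i < size p) `|p`_i| * i`!%:R).
  by apply: sumr_ge0 => i _; rewrite mulr_ge0.
move=> y y0; rewrite horner_coef mulr_suml.
apply: le_trans (ler_norm_sum _ _ _) _; apply: ler_sum => i _.
rewrite -mulrA normrM ler_wpM2l// ger0_norm ?exprM_expRN_le//.
by rewrite mulr_ge0 ?expR_ge0 ?exprn_ge0.
Qed.

(** The function p(1/x) exp(-1/x) extended by 0 to x <= 0.  This family is
    stable under differentiation, [flat_deriv] being the induced operation on
    the polynomial p; hence all its members are smooth. *)
Definition flat (p : {poly R}) (x : R) : R :=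
  if 0 < x then p.[x^-1] * expR (- x^-1) else 0.

Definition flat_deriv (p : {poly R}) : {poly R} := 'X^2 * (p - p^`()).

Lemma is_derive_flat (p : {poly R}) (x : R) :
  is_derive x 1 (flat p) (flat (flat_deriv p) x).
Proof.
have [x0|x0|<-] := ltgtP 0 x.
- have xn0 : x != 0 by rewrite gt_eqF.
  have dV : is_derive x (1:R) (fun y : R => y^-1) (- x ^- 2).
    by have := is_deriveV xn0 (is_derive_id x (1:R)); rewrite /GRing.scale/= mulr1.
  have dp : is_derive x (1:R) (fun y : R => p.[y^-1]) (p^`().[x^-1] * - x ^- 2).
    exact: is_derive1_comp (is_derive_poly p x^-1) dV.
  have de : is_derive x (1:R) (fun y : R => expR (- y^-1))
      (expR (- x^-1) * - - x ^- 2).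
    by apply: (@is_derive1_comp _ expR (fun y : R => - y^-1)); exact: is_deriveN.
  have E : is_derive x 1 (fun y : R => p.[y^-1] * expR (- y^-1))
      (flat (flat_deriv p) x).
    apply: is_derive_eq (is_deriveM dp de) _.
    rewrite /flat x0 /flat_deriv !hornerE/= /GRing.scale/= exprVn.
    by ring.
  apply: near_eq_is_derive E.
  by near=> y; rewrite /flat ifT//; near: y; exact: lt_nbhsr.
- have -> : flat (flat_deriv p) x = 0 by rewrite /flat ltNge (ltW x0).
  apply: near_eq_is_derive (is_derive_cst (0:R) x 1).
  near=> y; rewrite /flat ifN// -leNgt; apply: ltW; near: y; exact: lt_nbhsl.
- have -> : flat (flat_deriv p) 0 = 0 by rewrite /flat ltxx.
  have [C C0 HC] := horner_expRN_bounded ('X^2 * p).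
  (* at 0, flat p is O(y^2), as p(t) t^2 exp(-t) is bounded for t = 1/y >= 0 *)
  have B y : `|flat p y| <= C * y ^+ 2.
    rewrite /flat; case: ifP => y0; last by rewrite normr0 mulr_ge0 ?sqr_ge0.
    rewrite -ler_pdivrMr ?exprn_gt0//; apply: le_trans (HC (y^-1) _).
      rewrite hornerM hornerXn -mulrA [leRHS]normrM mulrC ger0_norm//.
        by rewrite exprVn.
      by rewrite exprn_ge0// invr_ge0 ltW.
    by rewrite invr_ge0 ltW.
  have L : h^-1 *: (flat p (h *: 1 + 0) - flat p 0) @[h --> 0^'] --> (0:R).
    apply/cvgr0Pnorm_le => e e0.
    have eC : 0 < e / (C + 1) by rewrite divr_gt0// ltr_wpDl.
    near=> h.
    rewrite addr0 [X in _ - X]/flat ltxx subr0 normrZ normfV [h *: 1]mulr1.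
    have h0 : h != 0 by near: h; exact: nbhs_dnbhs_neq.
    rewrite ler_pdivrMl ?normr_gt0//; apply: le_trans (B h) _.
    rewrite -real_normK ?num_real// expr2 mulrCA ler_wpM2l//.
    have he : `|h| < e / (C + 1).
      by near: h; apply: dnbhs0_lt.
    apply: le_trans (_ : (C + 1) * `|h| <= _); first by rewrite ler_wpM2r// lerDl.
    by rewrite mulrC -ler_pdivlMr ?ltr_wpDl// ltW.
  split; first by apply/cvg_ex; exists 0.
  exact: cvg_lim L.
Unshelve. all: by end_near. Qed.

Lemma flat_le0 p x : x <= 0 -> flat p x = 0.
Proof. by move=> x0; rewrite /flat ltNge x0. Qed.

End flat.

(** * Closure properties of smooth functions *)

Section smooth_functions.
Set Implicit Arguments.
Context {R : realType} {d : nat}.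
Implicit Types f g : 'rV[R]_d -> R.

Lemma CkW k f : Ck k.+1 f -> Ck k f.
Proof.
elim: k f => [|k IH] f; first by move=> [df _] x; exact: differentiable_continuous.
by move=> [df pf]; split=> // i; exact: IH.
Qed.

Lemma partialD i f g (x : 'rV[R]_d) : differentiable f x -> differentiable g x ->
  partial i (fun y => f y + g y) x = partial i f x + partial i g x.
Proof. by move=> df dg; exact: (deriveD (diff_derivable df) (diff_derivable dg)). Qed.

Lemma partialM i f g (x : 'rV[R]_d) : differentiable f x -> differentiable g x ->
  partial i (fun y => f y * g y) x = f x * partial i g x + g x * partial i f x.
Proof. by move=> df dg; exact: (deriveM (diff_derivable df) (diff_derivable dg)). Qed.

Lemma partial_comp i (phi : R -> R) f (x : 'rV[R]_d) (a : R) :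
  differentiable f x -> is_derive (f x) 1 phi a ->
  partial i (fun y => phi (f y)) x = a * partial i f x.
Proof.
move=> df dphi; have dphi' : differentiable phi (f x).
  by apply/derivable1_diffP; exact: ex_derive.
rewrite /partial deriveE; last exact: differentiable_comp.
rewrite (@diff_comp _ _ _ _ f phi)//= [in RHS]deriveE//.
set h := 'd f x _.
have -> : 'd phi (f x) h = h *: 'd phi (f x) (1 : R).
  by rewrite -linearZ/= [h *: 1]mulr1.
by rewrite -deriveE// derive_val mulrC.
Qed.

Lemma partial_cst i (c : R) : partial i (fun _ : 'rV[R]_d => c) = (fun=> 0).
Proof. by apply/funext => x; exact: derive_cst. Qed.

Lemma Ck_cst k (c : R) : Ck k (fun _ : 'rV[R]_d => c).
Proof.
elim: k c => [|k IH] c /=; first exact: cst_continuous.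
by split=> [x|i]; [exact: differentiable_cst|rewrite partial_cst].
Qed.

Lemma CkD k f g : Ck k f -> Ck k g -> Ck k (fun x => f x + g x).
Proof.
elim: k f g => [|k IH] f g /=; first by move=> cf cg x; exact: (cvgD (cf x) (cg x)).
move=> [df pf] [dg pg]; split=> [x|i]; first exact: differentiableD.
have -> : partial i (fun x => f x + g x) = fun x => partial i f x + partial i g x.
  by apply/funext => x; exact: partialD.
exact: IH.
Qed.

Lemma CkM k f g : Ck k f -> Ck k g -> Ck k (fun x => f x * g x).
Proof.
elim: k f g => [|k IH] f g; first by move=> cf cg x; exact: (cvgM (cf x) (cg x)).
move=> Cf Cg; move: (Cf) (Cg) => [df pf] [dg pg].
split=> [x|i]; first exact: differentiableM.
have -> : partial i (fun x => f x * g x) =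
    fun x => f x * partial i g x + g x * partial i f x.
  by apply/funext => x; exact: partialM.
by apply: CkD; apply: IH; [exact: CkW Cf|exact: pg|exact: CkW Cg|exact: pf].
Qed.

(** Here [phi] lists a function of one variable with its successive
    derivatives. *)
Lemma Ck_comp (phi : nat -> R -> R) :
  (forall n (x : R), is_derive x 1 (phi n) (phi n.+1 x)) ->
  forall k n f, Ck k f -> Ck k (fun x => phi n (f x)).
Proof.
move=> dphi.
have diffphi n x : differentiable (phi n) x.
  by apply/derivable1_diffP; have [] := dphi n x.
elim=> [|k IH] n f Cf.
  move=> x; apply: (@continuous_comp _ _ _ f (phi n)); first exact: Cf.
  exact: differentiable_continuous.
move: (Cf) => [df pf]; split=> [x|i].
  exact: (@differentiable_comp _ _ _ _ f (phi n)).
have -> : partial i (fun x => phi n (f x)) =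
    fun x => phi n.+1 (f x) * partial i f x.
  by apply/funext => x; exact: partial_comp.
by apply: CkM; [apply: IH; exact: CkW Cf|exact: pf].
Qed.

Lemma smooth_differentiable f (x : 'rV[R]_d) : smooth f -> differentiable f x.
Proof. by move=> /(_ 1%N)[]. Qed.

Lemma smooth_continuous f : smooth f -> continuous f.
Proof. by move=> /(_ 0%N). Qed.

Lemma smooth_partial i f : smooth f -> smooth (partial i f).
Proof. by move=> sf k; have [_] := sf k.+1; exact. Qed.

Lemma smooth_cst (c : R) : smooth (fun _ : 'rV[R]_d => c).
Proof. by move=> k; exact: Ck_cst. Qed.

Lemma smoothD f g : smooth f -> smooth g -> smooth (fun x => f x + g x).
Proof. by move=> sf sg k; exact: CkD. Qed.

Lemma smoothM f g : smooth f -> smooth g -> smooth (fun x => f x * g x).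
Proof. by move=> sf sg k; exact: CkM. Qed.

Lemma smoothN f : smooth f -> smooth (fun x => - f x).
Proof.
move=> sf; have -> : (fun x => - f x) = (fun x => -1 * f x).
  by apply/funext => x; rewrite mulN1r.
by apply: smoothM => //; exact: smooth_cst.
Qed.

Lemma smooth_sum (I : Type) (s : seq I) (F : I -> 'rV[R]_d -> R) :
  (forall i, smooth (F i)) -> smooth (fun x => \sum_(i <- s) F i x).
Proof.
move=> sF; elim: s => [|i s IH].
  by under [fun x => _]funext do rewrite big_nil; exact: smooth_cst.
by under [fun x => _]funext do rewrite big_cons; exact: smoothD.
Qed.

Lemma smooth_comp (phi : nat -> R -> R) f :
  (forall n (x : R), is_derive x 1 (phi n) (phi n.+1 x)) ->
  smooth f -> smooth (fun x => phi 0%N (f x)).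
Proof. by move=> dphi sf k; exact: Ck_comp. Qed.

Lemma smooth_coord j : smooth (fun x : 'rV[R]_d => x 0 j).
Proof.
case=> [|k]; first exact: coord_continuous.
split=> [x|i]; first exact: differentiable_coord.
have -> : partial i (fun x : 'rV[R]_d => x 0 j) = fun=> (delta_mx 0 i : 'rV[R]_d) 0 j.
  apply/funext => x; have dx := @differentiable_coord R _ _ x 0 j.
  rewrite /partial deriveE//.
  have L : linear (fun x : 'rV[R]_d => x 0 j : R) by move=> a u v; rewrite !mxE.
  pose LM := GRing.isLinear.Build _ _ _ _ _ L.
  pose l : {linear 'rV[R]_d -> R} := HB.pack (fun x : 'rV[R]_d => x 0 j : R) LM.
  by rewrite (@diff_lin _ _ _ l)//; exact: coord_continuous.
exact: Ck_cst.
Qed.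

Lemma smooth_dotv_grad (e : 'rV[R]_d) f : smooth f -> smooth (fun x => dotv e (grad f x)).
Proof.
move=> sf; have -> : (fun x => dotv e (grad f x)) = fun x => \sum_i e 0 i * partial i f x.
  by apply/funext => x; apply: eq_bigr => i _; rewrite mxE.
by apply: smooth_sum => i; apply: smoothM; [exact: smooth_cst|exact: smooth_partial].
Qed.

Lemma smooth_expR f : smooth f -> smooth (fun x => expR (f x)).
Proof. exact: (@smooth_comp (fun=> expR)). Qed.

Lemma smooth_flat p f : smooth f -> smooth (fun x => flat p (f x)).
Proof.
apply: (@smooth_comp (fun n => flat (iter n flat_deriv p))) => n x /=.
exact: is_derive_flat.
Qed.

End smooth_functions.

(** * Functions supported in a ball *)

Section supported.
Set Implicit Arguments.
Context {R : realType} {d : nat}.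
Implicit Types (f g : 'rV[R]_d -> R).

Lemma normr_rV_leP (x : 'rV[R]_d) (r : R) : 0 <= r ->
  (`|x| <= r) <-> (forall i, `|x 0 i| <= r).
Proof.
move=> r0; rewrite [`|x|]/Num.Def.normr/= mx_normrE; split.
  by move=> /bigmax_leP[_ H] i; exact: (H (0, i)).
by move=> H; apply/bigmax_leP; split=> // -[i j] _ /=; rewrite ord1.
Qed.

Lemma coord_normr_le (x : 'rV[R]_d) i : `|x 0 i| <= `|x|.
Proof. by move: i; apply/normr_rV_leP. Qed.

(** [f] vanishes outside the closed ball of radius [r] for the sup norm; this
    norm makes the ball a box, whose Lebesgue measure is explicit. *)
Definition supported (r : R) f : Prop := forall x, r < `|x| -> f x = 0.

Lemma supportedMr r f g : supported r f -> supported r (fun x => f x * g x).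
Proof. by move=> sf x rx; rewrite sf// mul0r. Qed.

Lemma supported_partial r f i : supported r f -> supported r (partial i f).
Proof.
move=> sf x rx; rewrite /partial (@near_eq_derive _ _ _ f (fun=> 0)) ?derive_cst//.
near=> y; apply: sf; near: y.
apply: (@cvgr_gt _ _ _ _ (fun y : 'rV[R]_d => `|y|) `|x|) => //.
exact: norm_continuous.
Unshelve. all: by end_near. Qed.

Lemma closed_normr_ball (r : R) : closed [set x : 'rV[R]_d | `|x| <= r].
Proof.
rewrite (_ : mkset _ = (fun x : 'rV[R]_d => `|x|) @^-1` [set y | y <= r])//.
by apply: closed_comp; [move=> x _; exact: norm_continuous|exact: closed_le].
Qed.

Lemma closed_normr_ball_compact (r : R) : compact [set x : 'rV[R]_d | `|x| <= r].
Proof.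
apply: bounded_closed_compact.
  exists r; split=> [|M rM x /= xr]; first exact: num_real.
  by apply: le_trans xr _; exact: ltW.
exact: closed_normr_ball.
Qed.

Lemma supported_bounded r f : 0 <= r -> continuous f -> supported r f ->
  exists2 M, 0 <= M & forall x, `|f x| <= M.
Proof.
move=> r0 cf sf.
have [|||c _ Hc] := @EVT_max_rV _ _ (fun x => `|f x|) [set x : 'rV[R]_d | `|x| <= r].
- by exists 0; rewrite /= normr0.
- exact: closed_normr_ball_compact.
- apply: continuous_subspaceT => x.
  by apply: (@continuous_comp _ _ _ f); [exact: cf|exact: norm_continuous].
exists `|f c| => // x; have [xr|rx] := leP `|x| r; first by apply: Hc; rewrite inE.
by rewrite sf// normr0.
Qed.

Lemma normr_ball_lebesgue_lty (r : R) : 0 <= r ->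
  (lebesgue_rV d [set x : 'rV[R]_d | `|x| <= r]%R < +oo)%E.
Proof.
move=> r0; pose A (i : 'I_d) : set (measurableTypeR R) := `[- r, r]%classic.
have -> : [set x : 'rV[R]_d | `|x| <= r] = [set x | forall i, A i (x 0 i)].
  apply/seteqP; split=> x /= => [/normr_rV_leP H i|H].
    by rewrite /A/= in_itv/= -ler_norml H.
  by apply/normr_rV_leP => // i; have := H i; rewrite /A/= in_itv/= -ler_norml.
rewrite lebesgue_rV_box => [|i]; last exact: measurable_itv.
suff : (0 <= \prod_(i < d) lebesgue_measure (A i) < +oo)%E by move=> /andP[].
elim/big_ind : _ => [|x y /andP[x0 xy] /andP[y0 yy]|i _].
- by rewrite lee01 ltry.
- by rewrite mule_ge0// lte_mul_pinfty// ge0_fin_numE.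
- by rewrite measure_ge0 lebesgue_measure_itv/=; case: ifP; rewrite ?ltry.
Qed.

Lemma supported_lebesgue_integrable r f : 0 <= r -> continuous f ->
  supported r f -> (lebesgue_rV d).-integrable setT (EFin \o f).
Proof.
move=> r0 cf sf; have [M M0 fM] := supported_bounded r0 cf sf.
pose B := [set x : 'rV[R]_d | `|x| <= r].
have mB : measurable B.
  rewrite -[B]setCK; apply: measurableC; apply: open_measurable_rV.
  by apply: closed_openC; exact: closed_normr_ball.
suff : (lebesgue_rV d).-integrable B (EFin \o f).
  move=> /integrable_mkcond => /(_ mB).
  apply: eq_integrable => // x _; rewrite /patch; case: ifPn => // /negP xB /=.
  by rewrite sf// ltNge; apply/negP => xr; apply: xB; rewrite inE.
apply: measurable_bounded_integrable => //.
- exact: normr_ball_lebesgue_lty r0.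
- by apply: measurable_funTS; exact: continuous_measurable_rV.
- exists M; split=> [|N MN x _]; first exact: num_real.
  by apply: le_trans (fM _) _; exact: ltW.
Qed.

End supported.

(** * Integration by parts on R^d *)

Section integration_by_parts.
Set Implicit Arguments.
Context {R : realType}.

Lemma integral_derive_supported (g : R -> R) (r : R) : 0 <= r ->
  (forall x, derivable g x 1) -> continuous ('D_1 g) ->
  (forall x, r < `|x| -> g x = 0) ->
  (\int[@lebesgue_measure R]_x ('D_1 g x)%:E = 0)%E.
Proof.
move=> r0 dg cg sg; set a := r + 1.
have ra : r < a by rewrite ltrDl.
have a0 : 0 < a by exact: le_lt_trans ra.
have sdg x : r < `|x| -> 'D_1 g x = 0.
  move=> rx; rewrite (@near_eq_derive _ _ _ g (fun=> 0)) ?derive_cst//.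
  near=> y; apply: sg; near: y.
  by apply: (@cvgr_gt _ _ _ _ (fun y : R => `|y|) `|x|) => //; exact: norm_continuous.
rewrite (_ : (\int[_]_x _)%E =
    (\int[lebesgue_measure]_(x in `[(- a)%R, a]) ('D_1 g x)%:E)%E); last first.
  rewrite [RHS]integral_mkcond; apply: eq_integral => x _.
  rewrite /patch; case: ifPn => // /negP xa; rewrite sdg//.
  rewrite ltNge; apply/negP => xr; apply: xa; rewrite inE/= in_itv/= -ler_norml.
  exact: le_trans xr (ltW ra).
have contg : continuous g.
  by move=> x; apply: differentiable_continuous; exact/derivable1_diffP.
rewrite (@continuous_FTC2 _ _ g).
- by rewrite !sg ?normrN ?gtr0_norm// subee.
- by rewrite gtrN.
- exact: continuous_subspaceT.
- split.
  + by move=> x _; exact: dg.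
  + by apply: cvg_at_right_filter; exact: contg.
  + by apply: cvg_at_left_filter; exact: contg.
- by move=> x _; rewrite derive1E.
Unshelve. all: by end_near. Qed.

(** A directional derivative only depends on the restriction to a line. *)
Lemma derive_line (V W : normedModType R) (f : V -> R) (g : W -> R) (a v : V) (b w : W) :
  (forall t : R, f (t *: v + a) = g (t *: w + b)) ->
  (derivable f a v <-> derivable g b w) /\ 'D_v f a = 'D_w g b.
Proof.
move=> fg; have fagb : f a = g b by have := fg 0; rewrite !scale0r !add0r.
have E : (fun t : R => t^-1 *: ((f \o shift a) (t *: v) - f a)) =
    (fun t : R => t^-1 *: ((g \o shift b) (t *: w) - g b)).
  by apply/funext => t /=; rewrite fagb fg.
by rewrite /derivable /derive E.
Qed.

Lemma continuous_rV_cons d :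
  continuous ((fun p => rV_cons p) : R * 'rV[R]_d -> 'rV[R]_d.+1).
Proof.
move=> p; apply/cvg_ballP => e e0.
have : nbhs p (ball p e) by exact: nbhsx_ballx.
apply: filterS => q [B1 [_ B2]].
split=> // i j; rewrite !mxE; case: unliftP => [k _|_]; last exact: B1.
exact: B2.
Qed.

Lemma normr_rV_cons_ge1 d (x : R) (v : 'rV[R]_d) : `|x| <= `|rV_cons (x, v)|.
Proof.
by have := coord_normr_le (rV_cons (x, v)) ord0; rewrite mxE unlift_none.
Qed.

Lemma normr_rV_cons_ge2 d (x : R) (v : 'rV[R]_d) : `|v| <= `|rV_cons (x, v)|.
Proof.
apply/normr_rV_leP => // j.
by have := coord_normr_le (rV_cons (x, v)) (lift ord0 j); rewrite mxE liftK.
Qed.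

Lemma rV_consD0 d (x t : R) (v : 'rV[R]_d) :
  rV_cons (t *: 1 + x, v) = t *: delta_mx 0 ord0 + rV_cons (x, v).
Proof.
apply/rowP => i; rewrite !mxE eqxx/=.
case: unliftP => [j ->|->]/=.
  by rewrite ?lift_eqF ?eq_liftF mulr0 add0r.
by [].
Qed.

Lemma rV_consDS d (x t : R) (v : 'rV[R]_d) (j : 'I_d) :
  rV_cons (x, t *: delta_mx 0 j + v) = t *: delta_mx 0 (lift ord0 j) + rV_cons (x, v).
Proof.
apply/rowP => i; rewrite !mxE eqxx/=.
case: unliftP => [k ->|->]/=.
  by rewrite !mxE eqxx (inj_eq lift_inj).
by rewrite ?lift_eqF ?eq_liftF mulr0 add0r.
Qed.

Lemma integral_lebesgue_rVS d (m : {sigma_finite_measure set 'rV[R]_d -> \bar R})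
    (f : 'rV[R]_d.+1 -> \bar R) : (lebesgue_rVS m).-integrable setT f ->
  (lebesgue_measure \x m)%E.-integrable setT (f \o @rV_cons R d) /\
  (\int[lebesgue_rVS m]_x f x =
   \int[(@lebesgue_measure R \x m)%E]_p f (rV_cons p))%E.
Proof.
move=> /integrableP[mf fi].
have E : forall g : 'rV[R]_d.+1 -> \bar R,
    (\int[lebesgue_rVS m]_x g x =
     \int[pushforward (@lebesgue_measure R \x m)%E (@rV_cons R d)]_x g x)%E.
  by move=> g; apply: eq_measure_integral; first exact: measurable_rV_cons.
have I : (lebesgue_measure \x m)%E.-integrable setT (f \o @rV_cons R d).
  apply/integrableP; split.
    by apply: measurableT_comp => //; exact: measurable_rV_cons.
  move: fi; rewrite E ge0_integral_pushforward//.
  - exact: measurable_rV_cons.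
  - exact: measurableT_comp.
split=> //; rewrite E integral_pushforward//.
exact: measurable_rV_cons.
Qed.

(** By induction on the dimension and Fubini: the inner integral is taken over
    the first coordinate when [i] is that coordinate, and over the other ones
    otherwise. *)
Lemma integral_partial_supported d (i : 'I_d) (h : 'rV[R]_d -> R) (r : R) :
  0 <= r -> (forall x, derivable h x (delta_mx 0 i)) ->
  continuous (partial i h) -> supported r h ->
  (\int[lebesgue_rV d]_x (partial i h x)%:E = 0)%E.
Proof.
move=> r0; elim: d i h => [[]//|d IH] i h dh ch sh.
have I := supported_lebesgue_integrable r0 ch (supported_partial i sh).
have [I2 ->] := integral_lebesgue_rVS I.
have cont_cons2 x : continuous (fun v : 'rV[R]_d => rV_cons (x, v)).
  move=> v; apply: (@continuous_comp _ (R * 'rV[R]_d)%type _ (fun v => (x, v))).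
    exact: (cvg_pair (cvg_cst (x : R)) (@cvg_id _ (nbhs v))).
  exact: continuous_rV_cons.
have cont_cons1 v : continuous (fun x : R => rV_cons (x, v : 'rV[R]_d)).
  move=> x; apply: (@continuous_comp _ (R * 'rV[R]_d)%type _ (fun x => (x, v))).
    exact: (cvg_pair (@cvg_id _ (nbhs (x : R))) (cvg_cst v)).
  exact: continuous_rV_cons.
case: (unliftP ord0 i) => [j ij|i0].
- rewrite -integral12_prod_meas1//; apply: integral0_eq => x _.
  pose g v := h (rV_cons (x, v)).
  have D v : (derivable g v (delta_mx 0 j) <->
      derivable h (rV_cons (x, v)) (delta_mx 0 i)) /\
      partial j g v = partial i h (rV_cons (x, v)).
    by apply: derive_line => t; rewrite /g rV_consDS ij.
  have P : partial j g = fun v => partial i h (rV_cons (x, v)).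
    by apply/funext => v; have [] := D v.
  have Z : (\int[lebesgue_rV d]_v (partial j g v)%:E = 0)%E.
    apply: IH.
    + by move=> v; have [[_ H] _] := D v; exact: H.
    + rewrite P => v.
      apply: (@continuous_comp _ _ _ (fun v => rV_cons (x, v)) (partial i h)).
        exact: cont_cons2.
      exact: ch.
    + by move=> v rv; apply: sh; apply: lt_le_trans rv _; exact: normr_rV_cons_ge2.
  by move: Z; rewrite P.
- rewrite -integral21_prod_meas1//; apply: integral0_eq => v _.
  pose g (x : R) := h (rV_cons (x, v)).
  have D x : (derivable g x 1 <->
      derivable h (rV_cons (x, v)) (delta_mx 0 i)) /\
      'D_1 g x = partial i h (rV_cons (x, v)).
    by apply: derive_line => t; rewrite /g rV_consD0 i0.
  have P : 'D_1 g = fun x => partial i h (rV_cons (x, v)).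
    by apply/funext => x; have [] := D x.
  have dg (x : R) : derivable g x 1 by have [[_ H] _] := D x; exact: H.
  have cg : continuous ('D_1 g).
    rewrite P => x.
    apply: (@continuous_comp _ _ _ (fun x : R => rV_cons (x, v)) (partial i h)).
      exact: cont_cons1.
    exact: ch.
  have sg (x : R) : r < `|x| -> g x = 0.
    by move=> rx; apply: sh; apply: lt_le_trans rx _; exact: normr_rV_cons_ge1.
  apply: etrans (@integral_derive_supported g r r0 dg cg sg).
  by apply: eq_integral => x _; have [_ ->] := D x.
Qed.

End integration_by_parts.

(** * The scalar inequalities *)

Section real_inequalities.
Set Implicit Arguments.
Context {R : realType}.

(** With y = c exp a, one has y ln y <= a y because c <= 1; replacing y by
    e + y in the left-hand side costs at most e (1 + M) if e <= 1 and y <= M. *)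
Lemma perturbed_xlnx_le (a c e M : R) : 0 <= c <= 1 -> c * expR a <= M ->
  0 < e <= 1 ->
  (e + c * expR a) * ln (e + c * expR a) <= a * (c * expR a) + e * (1 + M).
Proof.
move=> /andP[c0 c1] cM /andP[e0 e1]; set y := c * expR a in cM *.
have y0 : 0 <= y by rewrite mulr_ge0 ?expR_ge0.
have ey0 : 0 < e + y by rewrite ltr_wpDr.
have h0 : e * ln (e + y) <= e * M.
  apply: ler_wpM2l; first exact: ltW.
  have -> : e + y = 1 + (e + y - 1) by ring.
  by apply: le_trans (le_ln1Dx _) _; lra.
suff : y * ln (e + y) <= a * y + e by rewrite mulrDl mulrDr mulr1; lra.
move: y0; rewrite le_eqVlt => /predU1P[<-|y0]; first by rewrite mul0r mulr0 add0r ltW.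
have c0' : 0 < c by move: y0; rewrite /y pmulr_lgt0 ?expR_gt0.
have L : ln (e + y) = ln c + a + ln (1 + e / y).
  have -> : e + y = y * (1 + e / y) by field; rewrite gt_eqF.
  rewrite lnM ?posrE ?ltr_wpDr ?divr_ge0 ?ltW//.
  by rewrite lnM ?posrE ?expR_gt0// expRK.
have h1 : ln (1 + e / y) <= e / y.
  apply: le_ln1Dx; apply: lt_le_trans (_ : 0 <= _); first by rewrite ltrN10.
  by rewrite divr_ge0// ltW.
rewrite L !mulrDr [y * a]mulrC; apply: lerD.
  by rewrite gerDr mulr_ge0_le0// ?ln_le0// ltW.
apply: le_trans (ler_wpM2l (ltW y0) h1) _.
by rewrite mulrCA divff ?mulr1// gt_eqF.
Qed.

(** As e -> 0 the hypothesis gives ln Z <= lambda p - p^2 / (2 beta) with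
    p = q / Z, and completing the square in p gives the conclusion. *)
Lemma legendre_bound (beta lambda Z q C : R) : 0 < beta -> 0 < Z -> 0 <= C ->
  (forall e, 0 < e <= 1 -> q ^+ 2 / (e + Z) <=
     2 * beta * (lambda * q + e * C - (e + Z) * ln (e + Z))) ->
  Z <= expR (beta * lambda ^+ 2 / 2).
Proof.
move=> b0 Z0 C0 H; rewrite -[leLHS]lnK ?posrE// ler_expR leNgt; apply/negP => lt.
set delta := ln Z - beta * lambda ^+ 2 / 2.
have d0 : 0 < delta by rewrite subr_gt0.
(* any e in ]0, 1] with e C < Z delta contradicts the hypothesis *)
set e := Num.min 1 (Z * delta / (C + 1)).
have C1 : 0 < C + 1 by rewrite ltr_wpDl.
have e0 : 0 < e by rewrite lt_min ltr01 divr_gt0// mulr_gt0.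
have e1 : e <= 1 by rewrite ge_min lexx.
have eC : e * (C + 1) <= Z * delta.
  by rewrite -ler_pdivlMr// ge_min lexx orbT.
have := H e; rewrite e0 e1 => /(_ isT).
set w := e + Z; have w0 : 0 < w by rewrite addr_gt0.
have lnw : ln Z <= ln w by rewrite ler_ln ?posrE// lerDr ltW.
rewrite ler_pdivrMr// => Hq.
have Hq2 : q ^+ 2 <= 2 * beta * (lambda * q + e * C - w * ln Z) * w.
  apply: le_trans Hq _; rewrite ler_pM2r// ler_pM2l ?mulr_gt0// lerD2l lerN2.
  by rewrite ler_pM2l.
have sq : 0 <= (q - beta * lambda * w) ^+ 2 by exact: sqr_ge0.
have key : 0 <= 2 * beta * w * (e * C - w * delta).
  apply: le_trans sq _; rewrite -subr_ge0.
  have -> : 2 * beta * w * (e * C - w * delta) - (q - beta * lambda * w) ^+ 2 =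
    2 * beta * (lambda * q + e * C - w * ln Z) * w - q ^+ 2.
    by rewrite /delta; field.
  by rewrite subr_ge0.
have : 0 <= e * C - w * delta by rewrite pmulr_rge0// in key; rewrite !mulr_gt0.
have : 0 < e * delta by rewrite mulr_gt0.
rewrite /w mulrDl; move: eC; rewrite mulrDr mulr1; lra.
Qed.

End real_inequalities.

(** * A smooth cutoff *)

Section euclidean.
Set Implicit Arguments.
Context {R : realType} {d : nat}.
Implicit Types u v e x : 'rV[R]_d.

Lemma dotv_ge0 u : 0 <= dotv u u.
Proof. by apply: sumr_ge0 => i _; rewrite -expr2 sqr_ge0. Qed.

Lemma sqr_norm2 u : norm2 u ^+ 2 = dotv u u.
Proof. by rewrite sqr_sqrtr// dotv_ge0. Qed.

(** Cauchy-Schwarz, from the nonnegativity of |u - <e, u> e|^2. *)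
Lemma sqr_dotv_le e u : norm2 e = 1 -> dotv e u ^+ 2 <= norm2 u ^+ 2.
Proof.
move=> e1; have ee : dotv e e = 1 by rewrite -sqr_norm2 e1 expr1n.
rewrite sqr_norm2 -subr_ge0.
have := dotv_ge0 (u - dotv e u *: e).
suff -> c : dotv (u - c *: e) (u - c *: e) =
    dotv u u - 2 * c * dotv e u + c ^+ 2 * dotv e e.
  by rewrite ee; set c := dotv e u; congr (0 <= _); ring.
rewrite /dotv !mulr_sumr -sumrB -big_split/=.
by apply: eq_bigr => i _; rewrite !mxE; ring.
Qed.

Lemma normr_le_norm2 x : `|x| <= norm2 x.
Proof.
apply/normr_rV_leP; first exact: sqrtr_ge0.
move=> i; rewrite -sqrtr_sqr ler_wsqrtr// /dotv (bigD1 i)//= -expr2 lerDl.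
by apply: sumr_ge0 => j _; rewrite -expr2 sqr_ge0.
Qed.

(** The bump exp(1 - 1 / (1 - (|x|/r)^2)) for the Euclidean norm, equal to 0
    when |x| >= r and normalised so that its maximum is 1; it converges to 1
    pointwise as r tends to infinity. *)
Definition cutoff (r : R) x : R := expR 1 * flat 1 (1 - dotv x x / r ^+ 2).

Lemma cutoff_supported r : 0 < r -> supported r (cutoff r).
Proof.
move=> r0 x rx; rewrite /cutoff flat_le0 ?mulr0// subr_le0 ler_pdivlMr ?exprn_gt0//.
rewrite mul1r -sqr_norm2 lerXn2r ?nnegrE ?(ltW r0) ?sqrtr_ge0//.
by apply: le_trans (ltW rx) _; exact: normr_le_norm2.
Qed.

Lemma cutoff_itv r x : 0 <= cutoff r x <= 1.
Proof.
rewrite /cutoff /flat hornerC mul1r; case: ifP => y0; last by rewrite mulr0 lexx ler01.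
rewrite mulr_ge0 ?expR_ge0//= -expRD expR_le1 subr_le0.
rewrite invf_ge1// gerBl; by rewrite divr_ge0 ?dotv_ge0 ?sqr_ge0.
Qed.

Lemma smooth_cutoff r : smooth (cutoff r).
Proof.
apply: smoothM; first exact: smooth_cst.
apply: smooth_flat; apply: smoothD; first exact: smooth_cst.
have -> : (fun x => - (dotv x x / r ^+ 2)) = fun x => (- (r ^+ 2)^-1) * dotv x x.
  by apply/funext => x; rewrite mulNr mulrC.
apply: smoothM; first exact: smooth_cst.
by apply: smooth_sum => i; apply: smoothM; exact: smooth_coord.
Qed.

Lemma cvg_cutoff x : cutoff n.+1%:R x @[n --> \oo] --> (1 : R).
Proof.
have E1 : expR 1 * flat 1 1 = 1 :> R.
  by rewrite /flat ltr01 hornerC mul1r invr1 -expRD subrr expR0.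
rewrite -[X in _ --> X]E1; apply: cvgM; first exact: cvg_cst.
have cf : continuous (flat 1 : R -> R).
  move=> y; apply: differentiable_continuous; apply/derivable1_diffP.
  by have [] := is_derive_flat 1 y.
apply: continuous_cvg; first exact: cf.
have h0 := @cvg_harmonic R.
have E : (fun n : nat => 1 - dotv x x / n.+1%:R ^+ 2) =
    (fun n => 1 - dotv x x * (harmonic n * harmonic n)).
  by apply/funext => n; rewrite expr2 invfM.
have L : 1 - dotv x x * (0 * 0) = 1 by rewrite !mulr0 subr0.
rewrite E -[X in _ --> X]L.
by apply: cvgB; [exact: cvg_cst|apply: cvgM; [exact: cvg_cst|exact: cvgM]].
Qed.

End euclidean.

(** * Expectations under a Gibbs measure *)

Section expectation_supported.
Set Implicit Arguments.
Context {R : realType} {d : nat}.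
Variable P : probability 'rV[R]_d R.
Implicit Types f g u : 'rV[R]_d -> R.

Lemma supported_sub_cst_integrable (r c : R) u : 0 <= r -> continuous u ->
  supported r (fun x => u x - c) -> P.-integrable setT (EFin \o u).
Proof.
move=> r0 cu su.
have cu' : continuous (fun x => u x - c).
  by move=> x; exact: (cvgB (cu x) (cvg_cst c)).
have [M M0 uM] := supported_bounded r0 cu' su.
have P1 : (P setT < +oo)%E by rewrite probability_setT ltry.
apply: measurable_bounded_integrable => //.
- exact: (continuous_measurable_rV cu).
- exists (M + `|c|); split=> [|N MN x _]; first exact: num_real.
  rewrite /= -[u x](subrK c); apply: le_trans (ler_normD _ _) _.
  by apply: le_trans (ltW MN); rewrite lerD2r.
Qed.

Lemma supported_integrable (r : R) u : 0 <= r -> continuous u -> supported r u ->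
  P.-integrable setT (EFin \o u).
Proof.
move=> r0 cu su; apply: (@supported_sub_cst_integrable r 0) => // x rx.
by rewrite su// subr0.
Qed.

Lemma espE f : esp P f = \int[P]_x f x.
Proof. by rewrite /esp unlock. Qed.

Lemma expectation_esp f : P.-integrable setT (EFin \o f) ->
  ('E_P[f] = (esp P f)%:E)%E.
Proof. by move=> If; rewrite /esp fineK// unlock; exact: integrable_fin_num. Qed.

Lemma smooth_density (V : 'rV[R]_d -> R) (c : R) : smooth V ->
  smooth (fun x => c * expR (- V x)).
Proof.
move=> sV; apply: smoothM; first exact: smooth_cst.
by apply: smooth_expR; exact: smoothN.
Qed.

(** The density agrees almost everywhere with the Radon-Nikodym derivative. *)
Lemma integral_gibbs (V f : 'rV[R]_d -> R) (c : R) : smooth V ->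
  (forall A, measurable A ->
    P A = (\int[lebesgue_rV d]_(x in A) (c * expR (- V x))%:E)%E) ->
  P.-integrable setT (EFin \o f) ->
  (\int[P]_x (f x)%:E =
   \int[lebesgue_rV d]_x (f x * (c * expR (- V x)))%:E)%E.
Proof.
move=> sV PV If; have /measurable_EFinP mf := measurable_int _ If.
pose w x := c * expR (- V x).
have cw : continuous w by exact/smooth_continuous/smooth_density.
have mw : measurable_fun setT (EFin \o w).
  by apply/measurable_EFinP; exact: continuous_measurable_rV.
have dom : P `<< lebesgue_rV d.
  move=> A nA B mB BA; rewrite PV// null_set_integral//; last exact: nA.
  exact: measurable_funTS.
rewrite -(Radon_Nikodym_change_of_variables dom)//.
have ae : ae_eq (lebesgue_rV d) setT
    (Radon_Nikodym (charge_of_finite_measure P) (lebesgue_rV d)) (EFin \o w).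
  apply: integral_ae_eq => //.
    exact: Radon_Nikodym_integrable.
  move=> E _ mE; rewrite -Radon_Nikodym_integral//; exact: PV.
apply: ae_eq_integral => //.
- apply: emeasurable_funM => //; exact/measurable_EFinP.
- by apply/measurable_EFinP; apply: measurable_funM => //;
  exact: continuous_measurable_rV.
- exact: (ae_eqe_mul2l (EFin \o f) ae).
Qed.

(** Integration by parts: apply [integral_partial_supported] to psi times the
    density, whose i-th logarithmic derivative is minus that of V. *)
Lemma esp_partial (V psi : 'rV[R]_d -> R) (r : R) (i : 'I_d) : is_gibbs P V ->
  smooth V -> 0 <= r -> smooth psi -> supported r psi ->
  esp P (partial i psi) = esp P (fun x => psi x * partial i V x).
Proof.
move=> [c c0 PV] sV r0 spsi supp.
pose w x := c * expR (- V x); pose h x := psi x * w x.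
have sN := smoothN sV.
have sw : smooth w by exact: smooth_density.
have sh : smooth h by exact: smoothM.
have pw x : partial i w x = - partial i V x * w x.
  have dV := smooth_differentiable x sV.
  rewrite /w (@partialM _ _ i (fun=> c) (fun x => expR (- V x))); last 2 first.
  - exact: differentiable_cst.
  - exact: (smooth_differentiable x (smooth_expR sN)).
  rewrite partial_cst mulr0 addr0.
  rewrite (@partial_comp _ _ i expR (fun x => - V x) x (expR (- V x)));
    last exact: (smooth_differentiable x sN).
  rewrite (_ : partial i (fun x => - V x) x = - partial i V x); last first.
    exact: (deriveN (diff_derivable dV)).
  by rewrite mulrN mulrN mulNr; congr (- _); ring.
have ph x : partial i h x = (partial i psi x - psi x * partial i V x) * w x.
  rewrite /h partialM ?pw; first by ring.
  - exact: (smooth_differentiable x spsi).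
  - exact: (smooth_differentiable x sw).
have s1 : supported r (partial i psi) by exact: supported_partial.
have s2 : supported r (fun x => psi x * partial i V x) by exact: supportedMr.
have c1 : continuous (partial i psi) by exact/smooth_continuous/smooth_partial.
have c2 : continuous (fun x => psi x * partial i V x).
  by apply/smooth_continuous/smoothM => //; exact: smooth_partial.
have I1 := supported_integrable r0 c1 s1.
have I2 := supported_integrable r0 c2 s2.
apply/eqP; rewrite -subr_eq0 !espE -RintegralB//; apply/eqP.
rewrite /Rintegral (@integral_gibbs V _ c sV PV).
- under eq_integral do rewrite -ph.
  rewrite (@integral_partial_supported _ _ i h r)//.
  + by move=> x; apply: diff_derivable; exact: smooth_differentiable.
  + exact/smooth_continuous/smooth_partial.
  + exact: supportedMr.
- exact: (integrableB _ I1 I2).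
Qed.

End expectation_supported.

(** * The truncated moment generating function *)

Section truncated_moment.
Set Implicit Arguments.
Context {R : realType} {d : nat}.
Variable P : probability 'rV[R]_d R.

(** The inequality |E grad f|^2 / E f <= 2 beta ent(f), for all smooth positive
    f such that the expectations of |grad f|, f and f |ln f| are finite. *)
Definition gradient_entropy_ineq (beta : R) : Prop :=
  forall f : 'rV[R]_d -> R, smooth f -> (forall x, 0 < f x) ->
    ('E_P[fun x => norm2 (grad f x)] < +oo)%E ->
    ('E_P[f] < +oo)%E ->
    ('E_P[fun x => (f x * `|ln (f x)|)%R] < +oo)%E ->
    norm2 (espv P (grad f)) ^+ 2 / esp P f <= 2 * beta * ent P f.

Lemma espD f g : P.-integrable setT (EFin \o f) -> P.-integrable setT (EFin \o g) ->
  esp P (fun x => f x + g x) = esp P f + esp P g.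
Proof. by move=> If Ig; rewrite !espE RintegralD. Qed.

Lemma espZl (a : R) f : P.-integrable setT (EFin \o f) ->
  esp P (fun x => a * f x) = a * esp P f.
Proof. by move=> If; rewrite !espE RintegralZl. Qed.

Lemma esp_cst (a : R) : esp P (fun=> a) = a.
Proof. by rewrite espE Rintegral_cst// [X in fine X]probability_setT mulr1. Qed.

Lemma esp_sum (I : Type) (s : seq I) (F : I -> 'rV[R]_d -> R) :
  (forall i, P.-integrable setT (EFin \o F i)) ->
  esp P (fun x => \sum_(i <- s) F i x) = \sum_(i <- s) esp P (F i).
Proof.
move=> IF; elim: s => [|i s IH].
  by under [fun x => _]funext do rewrite big_nil; rewrite big_nil esp_cst.
under [fun x => _]funext do rewrite big_cons.
rewrite big_cons espD ?IH//.
have := @integrable_sum _ _ _ P setT measurableT I s xpredT _ (fun i _ => IF i).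
apply: eq_integrable => // x _ /=; by rewrite sumEFin.
Qed.

Lemma expectation_lty f : P.-integrable setT (EFin \o f) -> ('E_P[f] < +oo)%E.
Proof. by move=> If; rewrite expectation_esp// ltry. Qed.

Lemma smooth_dotv (f g : 'rV[R]_d -> 'rV[R]_d) : (forall i, smooth (fun x => f x 0 i)) ->
  (forall i, smooth (fun x => g x 0 i)) -> smooth (fun x => dotv (f x) (g x)).
Proof. by move=> sf sg; apply: smooth_sum => i; exact: smoothM. Qed.

Section truncated.
Variables (beta : R) (V : 'rV[R]_d -> R) (e : 'rV[R]_d) (lambda r : R).
Hypotheses (b0 : 0 < beta) (sV : smooth V) (gV : is_gibbs P V)
  (ineq : gradient_entropy_ineq beta) (e1 : norm2 e = 1) (r0 : 0 < r).

(* the score in direction e, and the truncation of exp(lambda s) *)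
Let s x := dotv e (grad V x).
Let psi x := cutoff r x * expR (lambda * s x).

Lemma smooth_truncated : smooth psi.
Proof.
apply: smoothM; first exact: smooth_cutoff.
apply/smooth_expR/smoothM; [exact: smooth_cst|exact: smooth_dotv_grad].
Qed.

Lemma supported_truncated : supported r psi.
Proof. by apply: supportedMr; exact: cutoff_supported. Qed.

Lemma esp_score_truncated :
  esp P (fun x => psi x * s x) = dotv e (espv P (grad psi)).
Proof.
have sp := smooth_truncated; have su := supported_truncated.
have I i : P.-integrable setT (EFin \o (fun x => psi x * partial i V x)).
  apply: (supported_integrable P (ltW r0)); last exact: supportedMr.
  by apply/smooth_continuous/smoothM => //; exact: smooth_partial.
have -> : (fun x => psi x * s x) =
    (fun x => \sum_i e 0 i * (psi x * partial i V x)).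
  apply/funext => x; rewrite /s /dotv mulr_sumr; apply: eq_bigr => i _.
  by rewrite mxE mulrCA.
rewrite esp_sum => [|i]; last first.
  exact: (integrableZl _ _ (I i)).
apply: eq_bigr => i _; rewrite espZl// mxE; congr (_ * _).
rewrite -(esp_partial i gV sV (ltW r0) sp su); congr (esp P _).
by apply/funext => x; rewrite mxE.
Qed.

Lemma esp_truncated_le : esp P psi <= expR (beta * lambda ^+ 2 / 2).
Proof.
have sp := smooth_truncated; have su := supported_truncated.
have r0' := ltW r0.
have cp := smooth_continuous sp.
have psi0 x : 0 <= psi x.
  by rewrite mulr_ge0 ?expR_ge0//; have /andP[] := cutoff_itv r x.
have [M M0 pM] := supported_bounded r0' cp su.
have [Z0|Z0] := leP (esp P psi) 0; first by apply: le_trans Z0 _; exact: expR_ge0.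
set Z := esp P psi in Z0 *.
pose q := esp P (fun x => psi x * s x).
have Ipsi := supported_integrable P r0' cp su.
have Ips : P.-integrable setT (EFin \o (fun x => psi x * s x)).
  apply: (supported_integrable P r0'); last exact: supportedMr.
  by apply/smooth_continuous/smoothM => //; exact: smooth_dotv_grad.
apply: (@legendre_bound _ beta lambda Z q (1 + M)) => //; first by rewrite addr_ge0.
move=> a /andP[a0 a1]; pose f x := a + psi x.
have sf : smooth f by apply: smoothD => //; exact: smooth_cst.
have f0 x : 0 < f x by rewrite ltr_wpDr.
have pf i : partial i f = partial i psi.
  apply/funext => x; rewrite /f partialD ?partial_cst ?add0r//.
  exact: smooth_differentiable.
have gf : grad f = grad psi.
  by apply/funext => x; apply/rowP => i; rewrite !mxE pf.
(* phi (f x) is continuous in x and equal to phi a outside a ball *)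
have phi_int (phi : R -> R) : (forall y, 0 < y -> {for y, continuous phi}) ->
    P.-integrable setT (EFin \o (fun x => phi (f x))).
  move=> cphi; apply: (@supported_sub_cst_integrable _ _ _ r (phi a)) => //.
    move=> x; apply: (@continuous_comp _ _ _ f phi); last exact: cphi.
    exact: smooth_continuous.
  by move=> x rx; rewrite /f su// addr0 subrr.
have If : P.-integrable setT (EFin \o f) by apply: (phi_int id) => y _; exact: cvg_id.
have Ifl : P.-integrable setT (EFin \o (fun x => f x * ln (f x))).
  apply: (phi_int (fun y => y * ln y)) => y y0.
  by apply: (@continuousM _ _ id (@ln R)) => //; exact: continuous_ln.
have Ifal : P.-integrable setT (EFin \o (fun x => f x * `|ln (f x)|)).
  apply: (phi_int (fun y => y * `|ln y|)) => y y0.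
  apply: (@continuousM _ _ id (fun y => `|ln y|)) => //.
  apply: continuous_comp; [exact: continuous_ln|exact: norm_continuous].
have sg i : smooth (fun x => grad psi x 0 i).
  have -> : (fun x => grad psi x 0 i) = partial i psi.
    by apply/funext => x; rewrite mxE.
  exact: smooth_partial.
have Ig : P.-integrable setT (EFin \o (fun x => norm2 (grad f x))).
  rewrite gf; apply: (@supported_integrable _ _ _ r) => //.
    move=> x.
    apply: (@continuous_comp _ _ _ (fun x => dotv (grad psi x) (grad psi x)));
      last exact: sqrt_continuous.
    by apply: smooth_continuous; exact: smooth_dotv.
  move=> x rx; rewrite /norm2 (_ : dotv _ _ = 0) ?sqrtr0// /dotv big1// => i _.
  by rewrite mxE (supported_partial i su _ rx) mul0r.
have := ineq sf f0 (expectation_lty Ig) (expectation_lty If) (expectation_lty Ifal).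
have espf : esp P f = a + Z.
  by rewrite /f espD ?esp_cst//; apply: finite_measure_integrable_cst.
rewrite gf /ent espf => H.
have aZ : 0 < a + Z by rewrite addr_gt0.
apply: le_trans (_ : norm2 (espv P (grad psi)) ^+ 2 / (a + Z) <= _).
  rewrite ler_pM2r ?invr_gt0// /q esp_score_truncated; exact: sqr_dotv_le.
apply: le_trans H _; rewrite ler_pM2l ?mulr_gt0// lerD2r.
have Ilq : P.-integrable setT (EFin \o (fun x => lambda * (psi x * s x))).
  exact: (integrableZl _ _ Ips).
have Ic : P.-integrable setT (EFin \o (fun _ : 'rV[R]_d => a * (1 + M))).
  exact: finite_measure_integrable_cst.
rewrite -(espZl lambda Ips) -[X in _ <= _ + X]esp_cst -espD// !espE.
apply: le_Rintegral => //; first exact: (integrableD _ Ilq Ic).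
move=> x _ /=.
have -> : lambda * (psi x * s x) = lambda * s x * psi x by ring.
apply: perturbed_xlnx_le; rewrite ?a0 ?cutoff_itv//.
exact: le_trans (ler_norm _) (pM x).
Qed.

End truncated.
End truncated_moment.

(** * Removing the cutoff *)

Section fatou_bound.
Set Implicit Arguments.
Context {d} {T : measurableType d} {R : realType}.

(** Fatou's lemma for a pointwise limit of functions with bounded integrals. *)
Lemma fatou_integral_le (mu : {measure set T -> \bar R}) (u : nat -> T -> R)
    (v : T -> R) (B : \bar R) :
  (forall n, measurable_fun setT (u n)) -> (forall n x, 0 <= u n x) ->
  (forall x, u n x @[n --> \oo] --> v x) ->
  (forall n, (\int[mu]_x (u n x)%:E <= B)%E) ->
  (\int[mu]_x (v x)%:E <= B)%E.
Proof.
move=> mu_ u0 uv uB.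
have -> : (\int[mu]_x (v x)%:E =
    \int[mu]_x limn_einf (fun n => (u n x)%:E))%E.
  apply: eq_integral => x _; apply/esym.
  have /cvg_limn_einf_sup[//] : (u n x)%:E @[n --> \oo] --> (v x)%:E.
  by apply: cvg_EFin; [exact: nearW|exact: uv].
apply: le_trans (fatou mu measurableT _ _) _.
- by move=> n; apply/measurable_EFinP.
- by move=> n x _; rewrite lee_fin.
rewrite limn_einf_lim; apply: lime_le; first exact: is_cvg_einfs.
apply: nearW => n; apply: le_trans (uB n).
by apply: ereal_inf_lbound; exists n => /=.
Qed.

End fatou_bound.

Theorem theorem1p2 (R : realType) (d : nat) (beta : R) (V : 'rV[R]_d -> R)
    (P : probability 'rV[R]_d R)
    (hbeta : 0 < beta) (hV : smooth V) (hP : is_gibbs P V)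
    (hineq : forall f : 'rV[R]_d -> R, smooth f -> (forall x, 0 < f x) ->
       ('E_P[fun x => norm2 (grad f x)] < +oo)%E ->
       ('E_P[f] < +oo)%E ->
       ('E_P[fun x => (f x * `|ln (f x)|)%R] < +oo)%E ->
       norm2 (espv P (grad f)) ^+ 2 / esp P f <= 2 * beta * ent P f) :
  sub_gaussian P (Num.sqrt beta) (grad V) /\
  (forall (e : 'rV[R]_d) (lambda : R), norm2 e = 1 ->
    ('E_P[fun x => expR (lambda * dotv e (grad V x))] <=
     (expR (beta * lambda ^+ 2 / 2))%:E)%E).
Proof.
suff key (e : 'rV[R]_d) (lambda : R) : norm2 e = 1 ->
    ('E_P[fun x => expR (lambda * dotv e (grad V x))] <=
     (expR (beta * lambda ^+ 2 / 2))%:E)%E.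
  by split=> // e lambda e1; rewrite sqr_sqrtr ?(ltW hbeta)// [_ * beta]mulrC; exact: key.
move=> e1; rewrite unlock.
apply: (@fatou_integral_le _ _ _ P
  (fun n x => cutoff n.+1%:R x * expR (lambda * dotv e (grad V x)))).
- move=> n; apply: continuous_measurable_rV; apply: smooth_continuous.
  exact: smooth_truncated.
- by move=> n x; rewrite mulr_ge0 ?expR_ge0//; have /andP[] := cutoff_itv n.+1%:R x.
- move=> x; rewrite -[X in _ --> X]mul1r; apply: cvgM; last exact: cvg_cst.
  exact: cvg_cutoff.
- move=> n; have r0 : 0 < n.+1%:R :> R by rewrite ltr0n.
  have I : P.-integrable setT
      (EFin \o (fun x => cutoff n.+1%:R x * expR (lambda * dotv e (grad V x)))).
    apply: (supported_integrable P (ltW r0)).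
      by apply: smooth_continuous; exact: smooth_truncated.
    exact: supported_truncated.
  have := expectation_esp P I; rewrite unlock => ->; rewrite lee_fin.
  exact: esp_truncated_le.
Qed.
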